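(* Let $\mathfrak{A}$ be a unital $C^*$-algebra and $a\in\mathfrak{A}$. Then for each $\mu\in W_{\mathfrak{A}}(a)$, we have $h_a^{\mathfrak{A}}(\mu)=h_{a^*}^{\mathfrak{A}}(\overline{\mu})$.
   Context: $\mathfrak{A}$ is a complex, nonzero, unital $C^*$-algebra with unit $\boldsymbol{1}$; its state space $\mathfrak{S}(\mathfrak{A})$ is the set of all positive linear functionals $f\in\mathfrak{A}^*$ with $\|f\|=f(\boldsymbol{1})=1$. For $a\in\mathfrak{A}$: $W_{\mathfrak{A}}(a)=\{f(a):f\in\mathfrak{S}(\mathfrak{A})\}$; $DW_{\mathfrak{A}}(a)=\{(f(a),f(a^*a)):f\in\mathfrak{S}(\mathfrak{A})\}\subset\mathbb{C}\times\mathbb{R}$; for $\mu\in W_{\mathfrak{A}}(a)$, $\mathscr{L}_{\mu}^{\mathfrak{A}}(a)=\{r:(\mu,r)\in DW_{\mathfrak{A}}(a)\}$; and the height function $h_a^{\mathfrak{A}}:W_{\mathfrak{A}}(a)\to\mathbb{R}$ is $h_a^{\mathfrak{A}}(\mu)=\sup\mathscr{L}_{\mu}^{\mathfrak{A}}(a)$. The same definitions are applied to $a^*$, so $h_{a^*}^{\mathfrak{A}}(\overline{\mu})=\sup\{f(aa^* ):f\in\mathfrak{S}(\mathfrak{A}),\,f(a^* )=\overline{\mu}\}$. *)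

(* Defs.v *)
From HB Require Import structures.
From mathcomp Require Import all_boot all_order all_algebra.
From mathcomp Require Import complex.
From mathcomp Require Import all_classical all_reals all_analysis.

Set Implicit Arguments.
Unset Strict Implicit.
Unset Printing Implicit Defensive.

Import Order.TTheory GRing.Theory Num.Theory.
Import numFieldNormedType.Exports.

Local Open Scope classical_set_scope.
Local Open Scope ring_scope.
Local Open Scope complex_scope.

(* HB rejects the join of CompleteNormedModule and GRing.Algebra (a missing join
   with Num.NumDomain), so the unital ring structure is part of the mixin and
   the algebra instances are attached to the sort of the structure afterwards.
   Together with cstar_oner_neq0 the C*-identity yields `|1| = 1. *)
HB.mixin Record isCStarAlgebra (R : realType) A
    of CompleteNormedModule [the numFieldType of R[i]] A := {
  cstar_one : A ;
  cstar_mul : A -> A -> A ;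
  star : A -> A ;
  cstar_mulA : associative cstar_mul ;
  cstar_mul1l : left_id cstar_one cstar_mul ;
  cstar_mul1r : right_id cstar_one cstar_mul ;
  cstar_mulDl : left_distributive cstar_mul +%R ;
  cstar_mulDr : right_distributive cstar_mul +%R ;
  cstar_oner_neq0 : cstar_one != 0 ;
  cstar_scaleAl : forall (c : R[i]) (x y : A),
    c *: cstar_mul x y = cstar_mul (c *: x) y ;
  cstar_scaleAr : forall (c : R[i]) (x y : A),
    c *: cstar_mul x y = cstar_mul x (c *: y) ;
  cstar_normM : forall x y : A, `|cstar_mul x y| <= `|x| * `|y| ;
  starD : forall x y : A, star (x + y) = star x + star y ;
  starZ : forall (c : R[i]) (x : A), star (c *: x) = (c^*)%C *: star x ;
  cstar_starM : forall x y : A,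
    star (cstar_mul x y) = cstar_mul (star y) (star x) ;
  starK : involutive star ;
  cstar_normr_starM : forall x : A, `|cstar_mul (star x) x| = `|x| ^+ 2
}.

#[short(type="cstarAlgType")]
HB.structure Definition CStarAlgebra (R : realType) :=
  {A of CompleteNormedModule [the numFieldType of R[i]] A & isCStarAlgebra R A}.

HB.instance Definition _ (R : realType) (A : cstarAlgType R) :=
  GRing.Zmodule_isNzRing.Build (CStarAlgebra.sort A)
    cstar_mulA cstar_mul1l cstar_mul1r cstar_mulDl cstar_mulDr cstar_oner_neq0.
HB.instance Definition _ (R : realType) (A : cstarAlgType R) :=
  GRing.Lmodule_isLalgebra.Build R[i] (CStarAlgebra.sort A) cstar_scaleAl.
HB.instance Definition _ (R : realType) (A : cstarAlgType R) :=
  GRing.Lalgebra_isAlgebra.Build R[i] (CStarAlgebra.sort A) cstar_scaleAr.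

Section CStarTheory.
Context {R : realType} {A : cstarAlgType R}.

Lemma normr_mulr_le (x y : A) : `|x * y| <= `|x| * `|y|.
Proof. exact: cstar_normM. Qed.

Lemma starM (x y : A) : star (x * y) = star y * star x.
Proof. exact: cstar_starM. Qed.

Lemma normr_starM (x : A) : `|star x * x| = `|x| ^+ 2.
Proof. exact: cstar_normr_starM. Qed.

End CStarTheory.

Section NumericalRange.
Context {R : realType} {A : cstarAlgType R}.
Implicit Types (f : {scalar A}) (a : A) (mu : R[i]) (r : R).

(* Norms are R[i]-valued (with zero imaginary part); complex.Re brings them
   back to R, where suprema are available. *)
Definition functional_norm f : R :=
  sup [set complex.Re `|f x| | x in [set x : A | `|x| <= 1]].

(* The order of R[i] is partial: 0 <= z means that z is real and nonnegative. *)
Definition positive_functional f : Prop := forall x : A, 0 <= f (star x * x).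

(* R[i]^o carries the topology of the norm of R[i]. *)
Definition state_space : set {scalar A} :=
  [set f : {scalar A} |
    [/\ continuous (f : A -> R[i]^o), positive_functional f,
        functional_norm f = 1 & f 1 = 1]].

Definition numrange a : set R[i] := [set f a | f in state_space].

Definition DWshell a : set (R[i] * R) :=
  [set p | exists2 f, state_space f & f a = p.1 /\ f (star a * a) = p.2%:C].

Definition fiber a mu : set R := [set r | DWshell a (mu, r)].

(* Only meaningful for mu in numrange a, where fiber a mu is nonempty and
   bounded; elsewhere sup takes its default value. *)
Definition height a mu : R := sup (fiber a mu).

End NumericalRange.

(* Main.v *)
Require Import Defs.
From HB Require Import structures.
From mathcomp Require Import all_boot all_order all_algebra.
From mathcomp Require Import complex.
From mathcomp Require Import all_classical all_reals all_analysis.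
From mathcomp Require Import ring lra.

Set Implicit Arguments.
Unset Strict Implicit.
Unset Printing Implicit Defensive.

Import Order.TTheory GRing.Theory Num.Theory.
Import numFieldNormedType.Exports.

Local Open Scope classical_set_scope.
Local Open Scope ring_scope.
Local Open Scope complex_scope.

(** It suffices to find, for every state f, a state g with g(a) = f(a) and
    f(a^* a) <= g(a a^* ); translating a by a scalar one may assume f(a) = 0.
    Put s = f(a^* a), p = f(a a) and q = f(a^* a a).  In the GNS space of f, with
    cyclic vector x, the compression of a to the span of the orthogonal vectors
    x and a x is a 2 x 2 matrix, which is unitarily equivalent to its transpose;
    this suggests a vector state g.  If s <= |p|, Cauchy-Schwarz shows that
    g = f works.  Otherwise
    g(b) = f(c^* b c) / f(c^* c) with c = t + a does, where t solves
    conj(t) p + t s + q = 0.  Working with f(y^* x) as an inner product makes the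
    GNS representation itself unnecessary. *)

(** * Order on [R[i]] and comparison of powers *)

Lemma ge0_Re (R : realType) (x : R[i]) : 0 <= x -> x = (complex.Re x)%:C.
Proof. by move=> x0; rewrite RRe_real// ger0_real. Qed.

(** If [y < x], the powers of [y / x] tend to 0, so some power of exponent [2 ^ N] lies below the
    inverse of [|K| + 1], against the hypothesis. *)
Lemma ler_of_expr2n (R : realType) (x y K : R) : 0 <= x -> 0 <= y ->
  (forall n, x ^+ (2 ^ n) <= K * y ^+ (2 ^ n)) -> x <= y.
Proof.
move=> x0 y0 xKy; rewrite leNgt; apply/negP => yx.
have xp : 0 < x by exact: le_lt_trans y0 yx.
have z1 : `|y / x| < 1 by rewrite ger0_norm ?divr_ge0// ltr_pdivrMr// mul1r.
have Kp : 0 < `|K| + 1 by rewrite ltr_wpDl.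
have /cvgrPdist_lt/(_ (`|K| + 1)^-1) := cvg_expr z1.
rewrite invr_gt0 => /(_ Kp) [N _ /(_ (2 ^ N)%N)] /=.
move=> /(_ (ltnW (ltn_expl N (ltnSn 1)))).
rewrite sub0r normrN ger0_norm ?exprn_ge0 ?divr_ge0// expr_div_n.
have xN : 0 < x ^+ (2 ^ N) by rewrite exprn_gt0.
rewrite ltr_pdivrMr// ltNge => /negP; apply.
rewrite mulrC ler_pdivrMr// mulrC (le_trans (xKy N))// ler_wpM2r ?exprn_ge0//.
by rewrite (le_trans (ler_norm _))// lerDl.
Qed.

Lemma lec_of_expr2n (R : realType) (x y K : R[i]) :
  0 <= x -> 0 <= y -> 0 <= K ->
  (forall n, x ^+ (2 ^ n) <= K * y ^+ (2 ^ n)) -> x <= y.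
Proof.
move=> x0 y0 K0 xKy; rewrite (ge0_Re x0) (ge0_Re y0) lecR.
apply: (@ler_of_expr2n _ _ _ (complex.Re K)).
- by rewrite -lecR -ge0_Re.
- by rewrite -lecR -ge0_Re.
- by move=> n; rewrite -lecR rmorphM !rmorphXn/= -!ge0_Re.
Qed.

(** * The involution and the norm of the unit *)

Section CStarBasics.
Context {R : realType} {A : cstarAlgType R}.
Implicit Types (x y : A).

Lemma star_inj : injective (star : A -> A).
Proof. exact: (can_inj starK). Qed.

Lemma star1 : star (1 : A) = 1.
Proof. by have := @starM _ _ (star 1 : A) 1; rewrite !mulr1 starK mulr1. Qed.

Lemma starN x : star (- x) = - star x.
Proof. by rewrite -scaleN1r starZ rmorphN rmorph1 scaleN1r. Qed.

Lemma starB x y : star (x - y) = star x - star y.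
Proof. by rewrite starD starN. Qed.

Lemma normr1_cstar : `|1 : A| = 1.
Proof.
have := @normr_starM _ _ (1 : A); rewrite star1 mulr1 expr2 => h.
have n0 : `|1 : A| != 0 by rewrite normr_eq0 oner_neq0.
by apply: (mulfI n0); rewrite -h mulr1.
Qed.

Lemma normrX_le x n : `|x ^+ n| <= `|x| ^+ n.
Proof.
elim: n => [|n IH]; first by rewrite !expr0 normr1_cstar.
by rewrite !exprS (le_trans (normr_mulr_le _ _))// ler_wpM2l.
Qed.

Lemma starX x n : star (x ^+ n) = star x ^+ n.
Proof. by elim: n => [|n IH]; rewrite ?star1// exprS exprSr starM IH. Qed.

End CStarBasics.

(** * Positive functionals: Cauchy-Schwarz and automatic contractivity *)

Section Positive.
Context {R : realType} {A : cstarAlgType R}.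
Context {f : {scalar A}} (f_ge0 : positive_functional f).
Implicit Types (x y a b : A) (k : R[i]).

(** Polarization: [f (star z * z)] is real for [z] equal to 1, [x], [x + 1] and [x + i]; the last
    two give the imaginary and the real part of the identity. *)
Lemma positive_star x : f (star x) = (f x)^*%C.
Proof.
have real z : (f (star z * z))^*%C = f (star z * z).
  by apply: conj_Creal; rewrite ger0_real.
have f1 := real 1; have fx := real x.
rewrite star1 mulr1 in f1.
have := real (x + (0 +i* 1) *: 1); have := real (x + 1).
rewrite !starD !starZ star1 !mulrDl !mulrDr !mul1r !mulr1.
rewrite -!scalerAl -!scalerAr !mul1r !mulr1 !scalerA !linearD !scalarZ.
move: f1 fx; move: (f 1) (f (star x * x)) (f x) (f (star x)).
move=> [? ?] [? ?] [p q] [p' q']; simpc.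
move=> [= h1] [= h2] [= h3] [= h4].
by congr (_ +i* _); lra.
Qed.

Lemma positive_subM x y : f (star (x - y) * (x - y)) =
  f (star x * x) - f (star x * y) - (f (star x * y))^*%C + f (star y * y).
Proof.
rewrite -positive_star starM starK starB mulrBl !mulrBr !linearB/=.
by ring.
Qed.

Lemma positive_cauchy_schwarz x y : 0 < f (star y * y) ->
  `|f (star y * x)| ^+ 2 <= f (star x * x) * f (star y * y).
Proof.
set B := f (star y * y) => B0.
pose k := f (star y * x) / B.
have := f_ge0 (x - k *: y).
rewrite positive_subM starZ -scalerAl -!scalerAr !scalarZ -/B.
have -> : f (star x * y) = (f (star y * x))^*%C by rewrite -positive_star starM starK.
rewrite /k rmorphM /= conjcK rmorphM/= fmorphV/=.
have -> : (conjc B) = B by apply: conj_Creal; rewrite ger0_real // ltW.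
move: (f (star y * x)) => c h.
rewrite sqr_normc -subr_ge0.
suff -> : f (star x * x) * B - c * c^*%C = B *
    (f (star x * x) - c / B * c^*%C - c^*%C / B * c + c^*%C / B * (c / B * B)).
  by rewrite mulr_ge0// ltW.
by field; rewrite gt_eqF.
Qed.

(* Iterating |f b|^2 <= f(b^2) for self-adjoint b gives |f b|^(2^n) <= K |b|^(2^n),
   which avoids square roots in A. *)
Lemma positive_norm_le K : f 1 = 1 -> 0 <= K -> (forall x, `|f x| <= K * `|x|) ->
  forall x, `|f x| <= `|x|.
Proof.
move=> f1 K0 fK.
have sqf x : `|f x| ^+ 2 <= f (star x * x).
  have := @positive_cauchy_schwarz x 1.
  by rewrite star1 !mul1r f1 mulr1; apply.
have self b : star b = b -> `|f b| <= `|b|.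
  move=> bb; apply: (lec_of_expr2n _ _ K0) => // n.
  apply: (@le_trans _ _ `|f (b ^+ (2 ^ n))|).
    elim: n => [|n IH]; first by rewrite !expr1.
    have sq := sqf (b ^+ (2 ^ n)).
    rewrite starX bb -expr2 in sq.
    rewrite expnSr !exprM (le_trans (lerXn2r _ _ _ IH)) ?nnegrE ?exprn_ge0//.
    rewrite [leRHS]ger0_norm//.
    by rewrite expr2 -{1}bb -starX f_ge0.
  by rewrite (le_trans (fK _))// ler_wpM2l// normrX_le.
move=> x.
(* The general case follows from the self-adjoint [star x * x] by the C*-identity: [|f x|^2 <= f
   (star x * x) <= |star x * x| = |x|^2]. *)
rewrite -(@ler_pXn2r _ 2)// ?nnegrE//.
rewrite (le_trans (sqf _))// -normr_starM.
rewrite (le_trans _ (self _ _))//; last by rewrite starM starK.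
by rewrite real_ler_norm// ger0_real.
Qed.

(** Any crude bound [K] improves to 1, which gives continuity; the norm 1 is attained at the
    unit. *)
Lemma state_of_bounded K : f 1 = 1 -> 0 <= K -> (forall x, `|f x| <= K * `|x|) ->
  state_space f.
Proof.
move=> f1 K0 fK; have fle := positive_norm_le f1 K0 fK.
split => //.
- move=> x; apply/cvgrPdist_lt => e e0.
  have /cvgrPdist_lt/(_ _ e0) := @cvg_id _ (nbhs x).
  apply: filterS => y /=; apply: le_lt_trans.
  by rewrite -[f x - f y](linearB f); exact: fle.
- apply/le_anti/andP; split.
    apply: sup_le_ub; first by exists (complex.Re `|f 0|), 0 => //=; rewrite normr0.
    move=> _ [x x1 <-]; rewrite -lecR -ge0_Re//.
    exact: le_trans (fle _) x1.
  apply: ub_le_sup; last by exists 1; rewrite ?f1 ?normr1//= normr1_cstar.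
  exists 1 => _ [x x1 <-]; rewrite -lecR -ge0_Re//.
  exact: le_trans (fle _) x1.
Qed.

End Positive.

Section State.
Context {R : realType} {A : cstarAlgType R}.
Context {f : {scalar A}} (fS : state_space f).
Implicit Types (x y a b : A) (k : R[i]).

Lemma state_norm_le x : `|f x| <= `|x|.
Proof.
case: fS => _ _ fn1 _.
(* Without a supremum, [sup] would take its default value 0, whereas the norm is 1. *)
have hs : has_sup [set complex.Re `|f x| | x in [set x : A | `|x| <= 1]].
  apply: contrapT => /sup_out; move: fn1; rewrite /functional_norm => -> /eqP.
  by rewrite oner_eq0.
have [->|x0] := eqVneq x 0; first by rewrite linear0 !normr0.
have nx : 0 < `|x| by rewrite normr_gt0.
have : complex.Re `|f (`|x|^-1 *: x)| <= 1.
  rewrite -fn1; apply: (sup_upper_bound hs); exists (`|x|^-1 *: x) => //=.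
  by rewrite normrZ normfV normr_id mulVf// gt_eqF.
rewrite -lecR -ge0_Re// scalarZ normrM normfV normr_id.
by rewrite mulrC ler_pdivrMr// mul1r.
Qed.

End State.

(** * Vector states and the dominating state *)

Section Compression.
Context {R : realType} {A : cstarAlgType R}.
Implicit Types (f : {scalar A}) (a b c : A) (k t : R[i]).

(** For [k] the inverse of [f (star c * c)], this is the vector state given by the class of [c] in
    the GNS space of [f]. *)
Definition compression f c k : A -> R[i] := fun b => k * f (star c * b * c).

Fact compression_linear f c k : linear_for *%R (compression f c k).
Proof.
move=> t x y; rewrite /compression mulrDr mulrDl -scalerAr -scalerAl.
by rewrite linearD linearZ /= mulrDr mulrCA.
Qed.

HB.instance Definition _ f c k :=
  GRing.isLinear.Build R[i] A R[i] *%R (compression f c k)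
    (compression_linear f c k).

Lemma compression_state f c : state_space f -> 0 < f (star c * c) ->
  state_space (compression f c (f (star c * c))^-1).
Proof.
move=> fS c0; have f_ge0 : positive_functional f by case: fS.
set k := _^-1; have k0 : 0 <= k by rewrite invr_ge0 ltW.
apply: (@state_of_bounded _ _ _ _ (k * (`|star c| * `|c|))).
- move=> x; rewrite /= /compression mulr_ge0//.
  by rewrite mulrA -starM -mulrA f_ge0.
- by rewrite /= /compression mulr1 mulVf// gt_eqF.
- by rewrite !mulr_ge0.
- move=> x; rewrite /= /compression normrM ger0_norm// -[leRHS]mulrA ler_wpM2l//.
  rewrite (le_trans (state_norm_le fS _))//.
  rewrite mulrAC (le_trans (normr_mulr_le _ _))// ler_wpM2r//.
  exact: normr_mulr_le.
Qed.

Lemma state_star_dominates0 f a : state_space f -> f a = 0 ->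
  exists g : {scalar A}, [/\ state_space g, g a = 0 &
    f (star a * a) <= g (a * star a)].
Proof.
move=> fS fa; have [_ f_ge0 _ f1] := fS.
have aa_ge0 : 0 <= f (a * star a) by rewrite -{1}(starK a) f_ge0.
set s := f (star a * a); set p := f (a * a); set q := f (star a * (a * a)).
have [s0|s0] := eqVneq s 0; first by exists f; rewrite s0.
have {}s0 : 0 < s by rewrite lt_neqAle eq_sym s0 f_ge0.
have sR : s^*%C = s by apply: conj_Creal; rewrite ger0_real// ltW.
have [sp|sp] := boolP (s ^+ 2 <= `|p| ^+ 2).
  (* Here [s^2 <= |p|^2 <= f (a * star a) * s], and [s] cancels. *)
  exists f; split => //.
  rewrite -(@ler_pM2r _ s)// -expr2 (le_trans sp)//.
  have := @positive_cauchy_schwarz _ _ _ f_ge0 (star a) a s0.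
  by rewrite starK -starM (positive_star f_ge0) normcJ.
have {}sp : s ^+ 2 - p * p^*%C != 0.
  by rewrite subr_eq0 -sqr_normc; apply: contraNneq sp => ->.
(* Cramer's rule for the equation of [t] and its conjugate, a linear system in [t] and [t^*%C] with
   determinant [s^2 - |p|^2]. *)
pose t := (p * q^*%C - s * q) / (s ^+ 2 - p * p^*%C).
have tE : t^*%C * p + t * s + q = 0.
  have -> : t^*%C = (p^*%C * q - s * q^*%C) / (s ^+ 2 - p * p^*%C).
    by rewrite /t rmorphM fmorphV !rmorphB/= !rmorphM/= !conjcK sR -expr2
      [_ * p]mulrC.
  by rewrite /t; field.
clearbody t.
have [c cdef] : exists c, c = t *: 1 + a by exists (t *: 1 + a).
have fstar : f (star a) = 0 by rewrite positive_star// fa rmorph0.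
have cE b : f (star c * b) = t^*%C * f b + f (star a * b).
  by rewrite cdef starD starZ star1 mulrDl -scalerAl mul1r linearD linearZ.
have fca : f (star c * a) = s by rewrite cE fa mulr0 add0r.
have fcaa : f (star c * (a * a)) = - (t * s).
  by rewrite cE -/p -/q; apply/eqP; rewrite -addr_eq0 addrAC tE.
have fcc : f (star c * c) = t * t^*%C + s.
  rewrite [in X in star _ * X]cdef mulrDr -scalerAr mulr1 linearD scalarZ fca.
  by rewrite -[star c]mulr1 cE f1 !mulr1 fstar addr0.
have cc0 : 0 < f (star c * c) by rewrite fcc ltr_wpDl// -sqr_normc exprn_ge0.
exists (compression f c (f (star c * c))^-1); split.
- exact: compression_state.
(* The equation for [t] makes [f (star c * a * c)] equal to [t * s - t * s]. *)
- rewrite /= /compression -mulrA.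
  have -> : a * c = t *: a + a * a by rewrite cdef mulrDr -scalerAr mulr1.
  by rewrite mulrDr -scalerAr linearD scalarZ fca fcaa subrr mulr0.
rewrite /= /compression mulrC ler_pdivlMr// fcc.
(* Bessel's inequality for [star a * c] against the orthogonal vectors 1 and a. *)
have := f_ge0 (star a * c - (s *: 1 - t^*%C *: a)).
rewrite positive_subM//.
(* The coefficients are those of the orthogonal projection of [star a * c], so the cross term and
   the squared norm of the projection agree, with value [s * f (star c * c)]. *)
have -> : f (star (star a * c) * (s *: 1 - t^*%C *: a)) = s * (t * t^*%C + s).
  rewrite starM starK mulrBr -!scalerAr mulr1 linearB !scalarZ -mulrA.
  by rewrite fca fcaa; ring.
have -> : f (star (s *: 1 - t^*%C *: a) * (s *: 1 - t^*%C *: a)) =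
    s * (t * t^*%C + s).
  rewrite starB !starZ star1 conjcK sR mulrBl !mulrBr -!scalerAl -!scalerAr.
   by rewrite mul1r mulr1 mul1r !linearB !scalarZ f1 fa fstar -/s /=; ring.
rewrite rmorphM rmorphD rmorphM/= sR conjcK.
rewrite starM starK => h; rewrite -subr_ge0.
apply: le_trans h _; rewrite le_eqVlt; apply/predU1P; left.
by rewrite -!mulrA; ring.
Qed.

End Compression.

(** * From dominating states to heights *)

Section Height.
Context {R : realType} {A : cstarAlgType R}.
Implicit Types (f : {scalar A}) (a : A) (mu : R[i]) (r : R).

(** Replacing [a] by [a - mu *: 1] lowers both sides by the same [|mu|^2], since [f] and [g] both
    take the value [mu] at [a]. *)
Lemma state_star_dominates f a : state_space f ->
  exists g : {scalar A}, [/\ state_space g, g a = f a &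
    f (star a * a) <= g (a * star a)].
Proof.
move=> fS; have [_ f_ge0 _ f1] := fS.
pose mu := f a.
have [|g [gS g0 le_fg]] := @state_star_dominates0 _ _ f (a - mu *: 1) fS.
  by rewrite linearB scalarZ f1 mulr1 subrr.
have [_ g_ge0 _ g1] := gS.
have ga : g a = mu.
  by move: g0; rewrite linearB scalarZ g1 mulr1 => /eqP; rewrite subr_eq0 => /eqP.
exists g; split => //; move: le_fg.
have -> : f (star (a - mu *: 1) * (a - mu *: 1)) =
    f (star a * a) - mu * mu^*%C.
  rewrite positive_subM// !starZ star1 -!scalerAl -!scalerAr !mulr1 !scalarZ.
  by rewrite (positive_star f_ge0) rmorphM/= conjcK f1 -/mu; ring.
have -> : g ((a - mu *: 1) * star (a - mu *: 1)) =
    g (a * star a) - mu * mu^*%C.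
  rewrite -[X in X * star _]starK starB starZ star1 (positive_subM g_ge0).
  rewrite !starZ star1 starK conjcK -!scalerAl -!scalerAr !mulr1 !scalarZ.
  by rewrite rmorphM/= conjcK g1 ga -/mu; ring.
by rewrite lerD2r.
Qed.

Lemma fiber_ubound a mu : has_ubound (fiber a mu).
Proof.
exists (complex.Re `|star a * a|) => r [f fS [_ /= fr]].
rewrite -lecR -ge0_Re// -fr; apply: le_trans (state_norm_le fS _).
by rewrite fr real_ler_norm// complex_real.
Qed.

Lemma height_le_star a mu : numrange a mu -> height a mu <= height (star a) mu^*%C.
Proof.
move=> [f fS fa]; have f_ge0 : positive_functional f by case: fS.
apply: sup_le_ub.
  (* The fiber must be nonempty for its supremum to be bounded by its upper bounds. *)
  exists (complex.Re (f (star a * a))), f => //; split => //=.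
  by rewrite -ge0_Re.
move=> r [g gS [/= ga gr]].
have [h [hS ha le_gh]] := state_star_dominates a gS.
have [_ h_ge0 _ _] := hS.
have aa_ge0 : 0 <= h (a * star a) by rewrite -{1}(starK a) h_ge0.
apply: (@le_trans _ _ (complex.Re (h (a * star a)))).
  by rewrite -lecR -gr -ge0_Re.
apply: ub_le_sup; first exact: fiber_ubound.
exists h => //; split => /=; first by rewrite positive_star// ha ga.
by rewrite starK -ge0_Re.
Qed.

End Height.

Theorem theorem2p13 (R : realType) (A : cstarAlgType R) (a : A) :
  forall mu : R[i], numrange a mu -> height a mu = height (star a) (mu^*)%C.
Proof.
move=> mu amu; apply/le_anti/andP; split; first exact: height_le_star.
(* The reverse inequality is the same one for [star a] and [mu^*%C], as both conjugations are
   involutive. *)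
rewrite -{2}(starK a) -{2}(conjcK mu); apply: height_le_star.
case: amu => f fS <-; exists f => //.
by rewrite positive_star//; case: fS.
Qed.
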